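(* If the cell averages and endpoint values all lie in $G$ but a midpoint value does not, then in general the updated cell average need not lie in $G$, and no constant CFL number can always ensure that it does. Precisely: there exist a one-dimensional conservation law $\partial_t\mathbf U+\partial_x\mathbf F(\mathbf U)=\mathbf 0$ and a convex invariant domain $G$ for it such that for every constant $c>0$ there exist a mesh, a time step $\Delta t^n>0$, cell averages $\{\overline{\mathbf U}^n_{j+\frac12}\}_{j\in\mathbb Z}$ and endpoint values $\{\mathbf U^n_j\}_{j\in\mathbb Z}$ with $$\overline{\mathbf U}^n_{j+\frac12},\ \mathbf U^n_j,\ \mathbf U^n_{j+1}\in G\qquad\text{for all } j,$$ $$\lambda_{\max}(\mathbf U^n_j,\mathbf U^n_{j+1})\,\frac{\Delta t^n}{\Delta x_{j+\frac12}}\le c\qquad\text{for all } j,$$ and an index $j$ with $\mathbf U^n_{j+\frac12}\notin G$, for which $$\overline{\mathbf U}^{n+1}_{j+\frac12}\notin G .$$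
   Context: The line is divided into cells $I_{j+\frac12}=[x_j,x_{j+1}]$ of size $\Delta x_{j+\frac12}>0$. The midpoint values are determined by $\mathbf U^n_{j+\frac12}=\frac32\overline{\mathbf U}^n_{j+\frac12}-\frac14(\mathbf U^n_j+\mathbf U^n_{j+1})$. The PAMPA cell-average update with continuous flux is $$\overline{\mathbf U}^{n+1}_{j+\frac12}=\overline{\mathbf U}^{n}_{j+\frac12}-\frac{\Delta t^n}{\Delta x_{j+\frac12}}\Big(\mathbf F(\mathbf U^n_{j+1})-\mathbf F(\mathbf U^n_j)\Big).$$ A convex invariant domain $G\subset\mathbb R^d$ is a convex set such that exact (entropy) solutions with initial data taking values in $G$ take values in $G$ for all later times; e.g. for a scalar law, $G=[U_{\min},U_{\max}]$ by the maximum principle. $\lambda_{\max}(\mathbf U_L,\mathbf U_R)\ge0$ is a wave speed estimate such that $\frac{\mathbf U_L+\mathbf U_R}{2}-\frac1{2\lambda}(\mathbf F(\mathbf U_R)-\mathbf F(\mathbf U_L))\in G$ for all $\mathbf U_L,\mathbf U_R\in G$ and all $\lambda>0$ with $\lambda\ge\lambda_{\max}(\mathbf U_L,\mathbf U_R)$; for a scalar law with convex or concave flux $f$ it is $\lambda_{\max}(u_L,u_R)=\max\{|f'(u_L)|,|f'(u_R)|\}$. *)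

(* Defs.v *)
From HB Require Import structures.
From mathcomp Require Import all_boot all_order all_algebra.
From mathcomp Require Import all_classical all_reals all_analysis.

Set Implicit Arguments.
Unset Strict Implicit.
Unset Printing Implicit Defensive.

Import Order.TTheory GRing.Theory Num.Theory.
Import numFieldNormedType.Exports.

Local Open Scope classical_set_scope.
Local Open Scope ring_scope.

(** * Conservation laws and their entropy solutions

    States are row vectors, and space-time points are pairs [(t, x)]. *)

Section ConservationLaw.
Context {R : realType} {d : nat}.
Local Notation V := 'rV[R]_d.
Local Notation mu := (@lebesgue_measure R).

Definition C1_flux (F : V -> V) : Prop :=
  (forall u, differentiable F u) /\ (forall v, continuous ('D_v F)).

(** The library's Jacobian acts on row vectors from the right, so it is the
    transpose of the usual one, which does not affect diagonalizability over
    the reals. *)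
Definition hyperbolic (F : V -> V) : Prop :=
  forall u, diagonalizable (jacobian F u).

Definition conservation_law (F : V -> V) : Prop :=
  C1_flux F /\ hyperbolic F.

Definition C2_entropy (eta : V -> R) : Prop :=
  [/\ forall u, differentiable eta u,
      forall v u, differentiable ('D_v eta : V -> R) u
    & forall v w, continuous ('D_w ('D_v eta : V -> R) : V -> R)].

(** The compatibility relation is the chain rule [dq = d eta o dF]. *)
Definition entropy_pair (F : V -> V) (eta q : V -> R) : Prop :=
  [/\ C2_entropy eta,
      convex_function setT eta,
      (forall u, differentiable q u)
    & forall u v, 'D_v q u = 'D_('D_v F u) eta u].

Definition dt (phi : R * R -> R) (p : R * R) : R :=
  derive1 (fun t => phi (t, p.2)) p.1.

Definition dx (phi : R * R -> R) (p : R * R) : R :=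
  derive1 (fun x => phi (p.1, x)) p.2.

(** Only the values on [t >= 0] are used below; the support may meet [t = 0]. *)
Definition test_function (phi : R * R -> R) : Prop :=
  [/\ continuous phi,
      forall p : R * R, derivable (fun t => phi (t, p.2)) p.1 1 /\
                        derivable (fun x => phi (p.1, x)) p.2 1,
      continuous (dt phi), continuous (dx phi)
    & exists M : R, forall p : R * R,
        M < `|p.1| \/ M < `|p.2| -> phi p = 0].

(** [int_0^oo int_R (h phi_t + k phi_x) dx dt + int_R h0 phi(0, x) dx] *)
Definition weak_form (h0 : R -> R) (h k : R * R -> R) (phi : R * R -> R)
    : \bar R :=
  (\int[mu \x mu]_(p in [set p : R * R | (0 <= p.1)%R])
       (h p * dt phi p + k p * dx phi p)%:E
   + \int[mu]_x (h0 x * phi (0%R, x))%:E)%E.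

(** Bounded everywhere: every class in L^oo has such a representative. *)
Definition bounded_measurable {disp} {T : measurableType disp} (U : T -> V)
    : Prop :=
  (forall i, measurable_fun setT (fun p => U p 0 i)) /\
  (exists M : R, forall p, `|U p| <= M).

Definition entropy_solution (F : V -> V) (U0 : R -> V) (U : R * R -> V)
    : Prop :=
  [/\ bounded_measurable U0,
      bounded_measurable U,
      (forall (i : 'I_d) phi, test_function phi ->
        weak_form (fun x => U0 x 0 i) (fun p => U p 0 i)
                  (fun p => F (U p) 0 i) phi = 0%E)
    & forall eta q, entropy_pair F eta q ->
        forall phi, test_function phi -> (forall p, 0 <= phi p) ->
        (0 <= weak_form (eta \o U0) (eta \o U) (q \o U) phi)%E].

(** Solutions are classes modulo null sets, so membership in [G] is meant
    almost everywhere. *)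
Definition convex_invariant_domain (F : V -> V) (G : set V) : Prop :=
  convex_set G /\
  forall U0 U, entropy_solution F U0 U ->
    {ae mu, forall x, G (U0 x)} ->
    {ae (mu \x mu)%E, forall p : R * R, 0 <= p.1 -> G (U p)}.

Definition wave_speed_estimate (F : V -> V) (G : set V)
    (lmax : V -> V -> R) : Prop :=
  forall UL UR, G UL -> G UR ->
    0 <= lmax UL UR /\
    forall l, 0 < l -> lmax UL UR <= l ->
      G (2^-1 *: (UL + UR) - (2 * l)^-1 *: (F UR - F UL)).

End ConservationLaw.

(** * The scheme

    The index [j] stands for [j + 1/2] in cell quantities: cell [j] is
    [[x j, x (j + 1)]]. *)

Section Scheme.
Context {R : realType} {d : nat}.
Local Notation V := 'rV[R]_d.

Definition mesh (x : int -> R) : Prop :=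
  (forall j, x j < x (j + 1)) /\
  (forall y, exists j, x j <= y <= x (j + 1)).

Definition cell_size (x : int -> R) (j : int) : R := x (j + 1) - x j.

Definition midpoint_value (Ubar U : int -> V) (j : int) : V :=
  (3 / 2) *: Ubar j - 4^-1 *: (U j + U (j + 1)).

Definition updated_average (F : V -> V) (x : int -> R) (tau : R)
    (Ubar U : int -> V) (j : int) : V :=
  Ubar j - (tau / cell_size x j) *: (F (U (j + 1)) - F (U j)).

End Scheme.

(* Main.v *)
Require Import Defs.
From HB Require Import structures.
From mathcomp Require Import all_boot all_order all_algebra.
From mathcomp Require Import all_classical all_reals all_analysis.
From mathcomp Require Import measurable_realfun ring lra.

Set Implicit Arguments.
Unset Strict Implicit.
Unset Printing Implicit Defensive.

Import Order.TTheory GRing.Theory Num.Theory.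
Import numFieldNormedType.Exports.

Local Open Scope classical_set_scope.
Local Open Scope ring_scope.

(** Linear advection [u_t + u_x = 0] with the invariant domain [u >= 0] already
    defeats every CFL number.  Take the average [0] in a cell with left value
    [0] and right value [1], both in the domain.  The midpoint value is [-1/4],
    and the update gives minus the ratio of time step to cell size: negative,
    however small that ratio is.  With finitely many states in use, any given
    wave speed estimate takes finitely many values, so one time step meets the
    CFL bound in all cells ([theorem4p3]).

    The substance is that the half-line is an invariant domain in the sense of
    entropy solutions ([nonneg_states_invariant]).  The function [neg_cube],
    which is [2 max(-u, 0)^3], is a [C^2] convex entropy that vanishes exactly
    on the half-line, and for advection it is its own flux
    ([neg_cube_entropy_pair]).  If the initial data are nonnegative, the entropy
    inequality for a nonnegative test function [phi] reads
    [int neg_cube(U) (phi_t + phi_x) >= 0] over [t >= 0].  Take for [phi] a bump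
    in [x - t] times a bump in [t + 1].  The derivative along characteristics
    [phi_t + phi_x] only sees the second factor, which decreases on [t >= 0];
    hence it is nonpositive there, and negative inside the support
    ([transport_lt0]).  A nonpositive integrand with a nonnegative integral
    vanishes almost everywhere, so [U >= 0] almost everywhere on that support,
    and the supports exhaust the half-plane as the bumps widen. *)

(** * Calculus of truncated powers *)

(** All truncated powers below are polynomials in [y] and [y * `|y|], so this
    is the one place where differentiability at a kink has to be checked. *)
Lemma is_derive_mul_abs (R : realType) (x : R) :
  is_derive x 1 (fun y : R => y * `|y|) (2 * `|x|).
Proof.
case: (ltgtP x 0) => [x0|x0|->].
- apply: (@near_eq_is_derive _ _ _ (- (id ^+ 2) : R -> R)).
    near=> y; have y0 : y < 0 by near: y; exact: lt_nbhsl.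
    by rewrite ltr0_norm //= mulrN.
  by apply: is_derive_eq; rewrite ltr0_norm // /GRing.scale /=; ring.
- apply: (@near_eq_is_derive _ _ _ (id ^+ 2 : R -> R)).
    near=> y; have y0 : 0 < y by near: y; exact: lt_nbhsr.
    by rewrite gtr0_norm.
  by apply: is_derive_eq; rewrite gtr0_norm // /GRing.scale /=; ring.
- rewrite normr0 mulr0.
  have quotient_cvg : (fun h : R =>
      h^-1 *: (((fun y : R => y * `|y|) \o shift 0) (h *: 1) - 0 * `|0 : R|))
      @ 0^' --> (0 : R).
    have quotientE : {near 0^', (fun h : R => `|h|) =1 (fun h : R =>
        h^-1 *: (((fun y : R => y * `|y|) \o shift 0) (h *: 1) - 0 * `|0 : R|))}.
      near=> h; have h0 : h != 0 by near: h; exact: nbhs_dnbhs_neq.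
      by rewrite /= /GRing.scale /= mulr1 addr0 mul0r subr0 mulKf.
    apply: cvg_trans; first exact: near_eq_cvg quotientE.
    have norm0 : Num.norm @ (0 : R) --> (0 : R).
      by have := @norm_continuous _ R^o 0; rewrite /continuous_at normr0.
    exact: cvg_within_filter norm0.
  by apply: DeriveDef; [exact: cvgP quotient_cvg|exact: cvg_lim quotient_cvg].
Unshelve. all: by end_near.
Qed.

(** This is [2 max(w, 0)^2]. *)
Definition sqpos (R : realType) (w : R) : R := w * `|w| + w ^+ 2.
Definition dsqpos (R : realType) (w : R) : R := 2 * `|w| + 2 * w.

Lemma is_derive_sqpos (R : realType) (w : R) :
  is_derive w 1 (@sqpos R) (dsqpos w).
Proof.
have H := is_derive_mul_abs w.
rewrite (_ : @sqpos R = (fun y : R => y * `|y|) + id ^+ 2) //.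
by apply: is_derive_eq; rewrite /dsqpos /GRing.scale /= expr1 mulr1.
Qed.

Lemma sqpos_ge0 (R : realType) (w : R) : 0 <= sqpos w.
Proof.
rewrite /sqpos; have [w0|w0] := leP 0 w.
  by rewrite ger0_norm // addr_ge0 ?sqr_ge0 ?mulr_ge0.
by rewrite ltr0_norm // (_ : _ + _ = 0) //; ring.
Qed.

Lemma sqpos_gt0 (R : realType) (w : R) : 0 < w -> 0 < sqpos w.
Proof.
by move=> w0; rewrite /sqpos gtr0_norm // addr_gt0 ?exprn_gt0 ?mulr_gt0.
Qed.

Lemma sqpos_eq0 (R : realType) (w : R) : w <= 0 -> sqpos w = 0.
Proof. by move=> w0; rewrite /sqpos ler0_norm //; ring. Qed.

Lemma dsqpos_ge0 (R : realType) (w : R) : 0 <= dsqpos w.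
Proof. by have := ler_norm (- w); rewrite normrN /dsqpos => ?; lra. Qed.

Lemma dsqpos_gt0 (R : realType) (w : R) : 0 < w -> 0 < dsqpos w.
Proof. by move=> w0; rewrite /dsqpos gtr0_norm //; lra. Qed.

(** This is [2 max(- u, 0)^3], as [neg_cubeE] shows; the polynomial form in
    [u] and [`|u|] is the one that is easy to differentiate twice. *)
Definition neg_cube (R : realType) (u : R) : R := u * (u * `|u|) - u ^+ 3.

Lemma is_derive_neg_cube (R : realType) (u : R) :
  is_derive u 1 (@neg_cube R) (3 * (u * `|u| - u ^+ 2)).
Proof.
have H := is_derive_mul_abs u.
rewrite (_ : @neg_cube R = id * (fun y : R => y * `|y|) - id ^+ 3) //.
by apply: is_derive_eq; rewrite /GRing.scale /=; ring.
Qed.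

Lemma is_derive2_neg_cube (R : realType) (u : R) :
  is_derive u 1 (fun u : R => 3 * (u * `|u| - u ^+ 2)) (6 * (`|u| - u)).
Proof.
have H := is_derive_mul_abs u.
rewrite (_ : (fun u : R => _) = cst 3 * ((fun y : R => y * `|y|) - id ^+ 2)) //.
by apply: is_derive_eq; rewrite /GRing.scale /=; ring.
Qed.

Lemma neg_cubeE (R : realType) (u : R) : neg_cube u = 2 * Num.max (- u) 0 ^+ 3.
Proof.
rewrite /neg_cube; have [u0|u0] := leP (- u) 0.
  by rewrite ger0_norm; [ring | lra].
by rewrite ltr0_norm; [ring | lra].
Qed.

Lemma neg_cube_ge0 (R : realType) (u : R) : 0 <= neg_cube u.
Proof. by rewrite neg_cubeE mulr_ge0 // exprn_ge0 // le_max lexx orbT. Qed.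

Lemma neg_cube_eq0 (R : realType) (u : R) : (neg_cube u == 0) = (0 <= u).
Proof.
rewrite neg_cubeE mulf_eq0 pnatr_eq0 /= expf_eq0 /=.
case: (leP (- u) 0) => H; first by rewrite eqxx -oppr_le0.
by rewrite gt_eqF // leNgt -oppr_gt0 H.
Qed.

(** The negative part is convex, and the cube is increasing and convex on the
    nonnegative reals, where its convexity defect factors explicitly. *)
Lemma neg_cube_convex (R : realType) (t a b : R) : 0 <= t -> t <= 1 ->
  neg_cube (t * a + (1 - t) * b) <= t * neg_cube a + (1 - t) * neg_cube b.
Proof.
move=> t0 t1; rewrite !neg_cubeE.
set p := Num.max (- a) 0; set q := Num.max (- b) 0.
have p0 : 0 <= p by rewrite le_max lexx orbT.
have q0 : 0 <= q by rewrite le_max lexx orbT.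
have pa : - a <= p by rewrite le_max lexx.
have qb : - b <= q by rewrite le_max lexx.
have m : Num.max (- (t * a + (1 - t) * b)) 0 <= t * p + (1 - t) * q.
  by rewrite ge_max; apply/andP; split; nra.
have /le_trans : 2 * Num.max (- (t * a + (1 - t) * b)) 0 ^+ 3 <=
                 2 * (t * p + (1 - t) * q) ^+ 3.
  rewrite ler_pM2l // lerXn2r // nnegrE ?le_max ?lexx ?orbT //.
  by rewrite addr_ge0 // mulr_ge0 // subr_ge0.
apply; rewrite -subr_ge0.
rewrite (_ : _ - _ =
  2 * (t * (1 - t) * (p - q) ^+ 2 * ((1 + t) * p + (2 - t) * q))); last by ring.
have pq0 : 0 <= (1 + t) * p + (2 - t) * q.
  by rewrite addr_ge0 // mulr_ge0 //; lra.
by rewrite mulr_ge0 // mulr_ge0 // mulr_ge0 ?sqr_ge0 // mulr_ge0 // subr_ge0.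
Qed.

(** * Advection and its entropy *)

Lemma advection_law (R : realType) (d : nat) :
  conservation_law (fun u : 'rV[R]_d => u).
Proof.
split; first split.
- by move=> u; exact: ex_diff.
- move=> v; rewrite (_ : 'D_v _ = cst v); first exact: cst_continuous.
  by apply/funext => u; rewrite derive_id.
- move=> u; rewrite (_ : jacobian _ _ = 1%:M); first exact: diagonalizable_scalar.
  apply/matrixP => i j; rewrite /jacobian mxE.
  by rewrite -deriveE ?derive_id ?mxE // eqxx eq_sym.
Qed.

(** Transfers calculus on the reals to states that are row vectors of
    length one. *)
Lemma derive_comp_coord (R : realType) (e : R -> R) (de : R) (u v : 'rV[R]_1) :
  is_derive (u 0 0) 1 e de ->
  differentiable (fun w : 'rV[R]_1 => e (w 0 0)) u /\
  'D_v (fun w : 'rV[R]_1 => e (w 0 0)) u = v 0 0 * de.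
Proof.
move=> He.
have diff_e : differentiable e (u 0 0) by apply/derivable1_diffP; exact: ex_derive.
have diff_coord : differentiable (fun w : 'rV[R]_1 => w 0 0 : R) u.
  exact: differentiable_coord.
have diff_ec := differentiable_comp diff_coord diff_e.
split; first exact: diff_ec.
rewrite (deriveE v diff_ec) diff_comp //= diff1E //= derive1E derive_val.
congr (_ * _).
have @f : {linear 'rV[R]_1 -> R}.
  by exists (fun N : 'rV[R]_1 => N 0 0); do 2![eexists]; do ?[constructor];
     rewrite ?mxE // => ? *; rewrite ?mxE //; move=> ?; rewrite !mxE.
by rewrite (_ : (fun _ => _) = f) // diff_lin //; exact: coord_continuous.
Qed.

Lemma neg_cube_entropy_pair (R : realType) :
  let eta := fun u : 'rV[R]_1 => neg_cube (u 0 0) in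
  entropy_pair (fun u : 'rV[R]_1 => u) eta eta.
Proof.
move=> eta.
have D1 (u v : 'rV[R]_1) := derive_comp_coord v (is_derive_neg_cube (u 0 0)).
have D1E v : 'D_v eta =
    fun u : 'rV[R]_1 => v 0 0 * (3 * (u 0 0 * `|u 0 0| - u 0 0 ^+ 2)).
  by apply/funext => u; exact: (D1 u v).2.
have D2 u v w : differentiable ('D_v eta : _ -> R) u /\
  'D_w ('D_v eta : _ -> R) u = w 0 0 * (v 0 0 * (6 * (`|u 0 0| - u 0 0))).
  rewrite D1E.
  apply: (@derive_comp_coord _ (fun s : R => v 0 0 * (3 * (s * `|s| - s ^+ 2)))).
  exact: is_deriveZ (is_derive2_neg_cube _).
split.
- split.
  + by move=> u; exact: (D1 u 0).1.
  + by move=> v u; exact: (D2 u v 0).1.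
  + move=> v w.
    rewrite (_ : 'D_w _ =
      fun u : 'rV[R]_1 => w 0 0 * (v 0 0 * (6 * (`|u 0 0| - u 0 0)))); last first.
      by apply/funext => u; exact: (D2 u v w).2.
    have cR : continuous (fun s : R => w 0 0 * (v 0 0 * (6 * (`|s| - s)))).
      move=> s.
      have H : (fun s : R => `|s| - s) @ s --> `|s| - s.
        by apply: cvgB; [exact: (cvg_norm (V := R^o))|exact: cvg_id].
      by do 3 (apply: cvgM; first exact: cvg_cst).
    move=> u.
    have c : (fun u : 'rV[R]_1 => u 0 0) @ u --> u 0 0 by exact: coord_continuous.
    exact: (cvg_comp _ _ c (cR (u 0 0))).
- by move=> t x y _ _; rewrite /eta !mxE; exact: neg_cube_convex.
- by move=> u; exact: (D1 u 0).1.
- by move=> u v; rewrite derive_id.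
Qed.

(** * A test function that decreases along characteristics *)

(** A [C^1] bump supported in [s ^+ 2 <= a]. *)
Definition bump (R : realType) (a s : R) : R := sqpos (a - s ^+ 2).
Definition dbump (R : realType) (a s : R) : R :=
  - (2 * s) * dsqpos (a - s ^+ 2).

Lemma is_derive_bump (R : realType) (a s : R) :
  is_derive s 1 (bump a) (dbump a s).
Proof.
have H := is_derive_sqpos (a - s ^+ 2).
have H' : is_derive s 1 (fun s : R => a - s ^+ 2) (- (2 * s)).
  rewrite (_ : (fun s : R => a - s ^+ 2) = cst a - id ^+ 2) //.
  by apply: is_derive_eq; rewrite /GRing.scale /= expr1 mulr1 add0r.
have := @is_derive1_comp _ (@sqpos R) (fun s : R => a - s ^+ 2) _ _ _ H H'.
by rewrite mulrC.
Qed.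

Lemma bump_eq0 (R : realType) (a s : R) :
  0 <= a -> a + 1 <= `|s| -> bump a s = 0.
Proof.
by move=> a0 s1; apply: sqpos_eq0; rewrite -real_normK ?num_real //; nra.
Qed.

Lemma continuous_bump (R : realType) (a : R) : continuous (bump a).
Proof.
move=> s; apply: differentiable_continuous; apply/derivable1_diffP.
by have H := is_derive_bump a s; exact: ex_derive.
Qed.

Lemma continuous_dbump (R : realType) (a : R) : continuous (dbump a).
Proof.
move=> s; apply: cvgM.
  by apply: cvgN; apply: cvgM; [exact: cvg_cst|exact: cvg_id].
have W : (fun s : R => a - s ^+ 2) @ s --> a - s ^+ 2.
  by apply: cvgB; [exact: cvg_cst|exact: exprn_continuous].
apply: cvgD; apply: cvgM => //; first exact: cvg_cst.
  exact: (cvg_norm (V := R^o)).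
exact: cvg_cst.
Qed.

(** The shift in time makes the first factor strictly decreasing already at
    [t = 0], so that the initial line needs no separate treatment. *)
Definition travelling_bump (R : realType) (a : R) (p : R * R) : R :=
  bump a (p.1 + 1) * bump a (p.2 - p.1).

Lemma is_derive_travelling_bump_t (R : realType) (a : R) (p : R * R) :
  is_derive p.1 1 (fun t => travelling_bump a (t, p.2))
    (dbump a (p.1 + 1) * bump a (p.2 - p.1) -
     bump a (p.1 + 1) * dbump a (p.2 - p.1)).
Proof.
have F : is_derive p.1 1 (fun t : R => bump a (t + 1)) (dbump a (p.1 + 1)).
  have L : is_derive p.1 1 (fun t : R => t + 1) 1.
    rewrite (_ : (fun t : R => t + 1) = id + cst 1) //.
    by apply: is_derive_eq; rewrite addr0.
  have := @is_derive1_comp _ _ (fun t : R => t + 1) _ _ _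
    (is_derive_bump a (p.1 + 1)) L.
  by rewrite mulr1.
have G : is_derive p.1 1 (fun t : R => bump a (p.2 - t)) (- dbump a (p.2 - p.1)).
  have L : is_derive p.1 1 (fun t : R => p.2 - t) (-1).
    rewrite (_ : (fun t : R => p.2 - t) = cst p.2 - id) //.
    by apply: is_derive_eq; rewrite sub0r.
  have := @is_derive1_comp _ _ (fun t : R => p.2 - t) _ _ _
    (is_derive_bump a (p.2 - p.1)) L.
  by rewrite mulrN1.
have := is_deriveM F G; rewrite /GRing.scale /=.
rewrite (_ : (_ * _)%R = (fun t : R => travelling_bump a (t, p.2))) //.
rewrite (_ : _ + _ = dbump a (p.1 + 1) * bump a (p.2 - p.1) -
                     bump a (p.1 + 1) * dbump a (p.2 - p.1)) //.
by ring.
Qed.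

Lemma is_derive_travelling_bump_x (R : realType) (a : R) (p : R * R) :
  is_derive p.2 1 (fun x => travelling_bump a (p.1, x))
    (bump a (p.1 + 1) * dbump a (p.2 - p.1)).
Proof.
have L : is_derive p.2 1 (fun x : R => x - p.1) 1.
  rewrite (_ : (fun x : R => x - p.1) = id - cst p.1) //.
  by apply: is_derive_eq; rewrite subr0.
have G := @is_derive1_comp _ _ (fun x : R => x - p.1) _ _ _
  (is_derive_bump a (p.2 - p.1)) L.
by have := is_deriveZ (bump a (p.1 + 1)) G; rewrite mulr1.
Qed.

Lemma dt_travelling_bump (R : realType) (a : R) :
  dt (travelling_bump a) = fun p => dbump a (p.1 + 1) * bump a (p.2 - p.1) -
                                    bump a (p.1 + 1) * dbump a (p.2 - p.1).
Proof.
apply/funext => p; have H := is_derive_travelling_bump_t a p.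
by rewrite /dt derive1E derive_val.
Qed.

Lemma dx_travelling_bump (R : realType) (a : R) :
  dx (travelling_bump a) = fun p => bump a (p.1 + 1) * dbump a (p.2 - p.1).
Proof.
apply/funext => p; have H := is_derive_travelling_bump_x a p.
by rewrite /dx derive1E derive_val.
Qed.

Lemma travelling_bump_test (R : realType) (a : R) :
  0 <= a -> test_function (travelling_bump a).
Proof.
move=> a0.
have ct (f : R -> R) : continuous f -> continuous (fun p : R * R => f (p.1 + 1)).
  move=> cf p.
  apply: (continuous_comp (f := fun p : R * R => p.1 + 1)); last exact: cf.
  by apply: cvgD; [exact: cvg_fst|exact: cvg_cst].
have cx (f : R -> R) :
    continuous f -> continuous (fun p : R * R => f (p.2 - p.1)).
  move=> cf p.
  apply: (continuous_comp (f := fun p : R * R => p.2 - p.1)); last exact: cf.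
  by apply: cvgB; [exact: cvg_snd|exact: cvg_fst].
have cb := @continuous_bump R a.
have cd := @continuous_dbump R a.
split.
- by move=> p; apply: cvgM; [exact: ct|exact: cx].
- move=> p; split.
  + by have H := is_derive_travelling_bump_t a p; exact: ex_derive.
  + by have H := is_derive_travelling_bump_x a p; exact: ex_derive.
- rewrite dt_travelling_bump => p.
  by apply: cvgB; apply: cvgM; [exact: ct|exact: cx|exact: ct|exact: cx].
- by rewrite dx_travelling_bump => p; apply: cvgM; [exact: ct|exact: cx].
- (* Both factors nonzero force [`|t + 1|, `|x - t| < a + 1], hence
     [`|t| < a + 2] and [`|x| < 2 * a + 3]. *)
  exists (2 * a + 3) => -[t x] /= h; rewrite /travelling_bump /=.
  have [t1|t1] := leP (a + 1) `|t + 1|; first by rewrite bump_eq0 ?mul0r.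
  rewrite [X in _ * X]bump_eq0 ?mulr0 //.
  have := ler_normD (x - t) t; rewrite subrK => ?.
  have := ler_normB (t + 1) 1; rewrite addrK normr1 => ?.
  by case: h => ?; lra.
Qed.

Lemma travelling_bump_ge0 (R : realType) (a : R) p : 0 <= travelling_bump a p.
Proof. by rewrite mulr_ge0 // sqpos_ge0. Qed.

Lemma transport_le0 (R : realType) (a : R) p : 0 <= p.1 ->
  dt (travelling_bump a) p + dx (travelling_bump a) p <= 0.
Proof.
move=> p0; rewrite dt_travelling_bump dx_travelling_bump subrK.
by rewrite mulr_le0_ge0 ?sqpos_ge0 // mulr_le0_ge0 ?dsqpos_ge0 //; lra.
Qed.

(** The derivatives of the factor in [x - t] cancel, which leaves
    [dbump a (t + 1) * bump a (x - t)]. *)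
Lemma transport_lt0 (R : realType) (a : R) p :
  0 <= p.1 -> (p.1 + 1) ^+ 2 < a -> (p.2 - p.1) ^+ 2 < a ->
  dt (travelling_bump a) p + dx (travelling_bump a) p < 0.
Proof.
move=> p0 h1 h2; rewrite dt_travelling_bump dx_travelling_bump subrK.
rewrite nmulr_rlt0 ?sqpos_gt0 ?subr_gt0 //.
by rewrite nmulr_rlt0 ?dsqpos_gt0 ?subr_gt0 //; lra.
Qed.

(** * Invariance of the half-line *)

Lemma le0_integral_ae_eq0 d (T : measurableType d) (R : realType)
    (mu : {measure set T -> \bar R}) (D : set T) (f : T -> R) :
  measurable D -> measurable_fun D f -> (forall x, D x -> f x <= 0) ->
  (0 <= \int[mu]_(x in D) (f x)%:E)%E -> {ae mu, forall x, D x -> f x = 0}.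
Proof.
move=> mD mf f0 If.
have mEf : measurable_fun D (fun x => (f x)%:E) by exact/measurable_EFinP.
have I0 : (\int[mu]_(x in D) `|(f x)%:E| = 0)%E.
  apply/eqP; rewrite eq_le; apply/andP; split; last exact: integral_ge0.
  rewrite -oppe_ge0 -integral_ge0N //.
  rewrite (eq_integral (fun x => (f x)%:E)) // => x /set_mem Dx.
  by rewrite /= ler0_norm ?f0 // opprK.
have := (ae_eq_integral_abs mu mD mEf).1 I0.
by apply: filterS => x /[apply] -[].
Qed.

Definition nonneg_states (R : realType) : set 'rV[R]_1 := [set u | 0 <= u 0 0].

Lemma nonneg_states_invariant (R : realType) :
  convex_invariant_domain (fun u : 'rV[R]_1 => u) (@nonneg_states R).
Proof.
split.
  move=> x y l; rewrite !inE /nonneg_states /= !mxE => x0 y0.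
  by apply: addr_ge0; apply: mulr_ge0 => //; rewrite subr_ge0.
move=> U0 U [[mU0 _] [mU _] _ entropy] U00.
set mu := @lebesgue_measure R.
set D : set (R * R) := [set p | (0 <= p.1)%R].
have mD : measurable D.
  rewrite (_ : D = fst @^-1` `[0, +oo[%classic).
    by rewrite -[X in measurable X]setTI; apply: measurable_fst.
  by apply/seteqP; split => p; rewrite /= in_itv /= andbT.
have mneg : measurable_fun setT (@neg_cube R).
  apply: continuous_measurable_fun => s; apply: differentiable_continuous.
  by apply/derivable1_diffP; have H := is_derive_neg_cube s; exact: ex_derive.
have dissipation (a : nat) : {ae (mu \x mu)%E, forall p : R * R, D p ->
    neg_cube (U p 0 0) *
    (dt (travelling_bump a%:R) p + dx (travelling_bump a%:R) p) = 0}.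
  apply: le0_integral_ae_eq0 => //.
  - apply: measurable_funTS.
    have mt (f : R -> R) : continuous f ->
        measurable_fun setT (fun p : R * R => f (p.1 + 1)).
      move=> cf; apply: (measurableT_comp (continuous_measurable_fun cf)).
      exact: measurable_funD.
    have mx (f : R -> R) : continuous f ->
        measurable_fun setT (fun p : R * R => f (p.2 - p.1)).
      move=> cf; apply: (measurableT_comp (continuous_measurable_fun cf)).
      exact: measurable_funB.
    have cb := @continuous_bump R a%:R.
    have cd := @continuous_dbump R a%:R.
    apply: measurable_funM; first exact: (measurableT_comp mneg (mU 0)).
    rewrite dt_travelling_bump dx_travelling_bump.
    apply: measurable_funD; last by apply: measurable_funM; [exact: mt|exact: mx].
    by apply: measurable_funB; apply: measurable_funM;
      [exact: mt|exact: mx|exact: mt|exact: mx].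
  - by move=> p Dp; rewrite mulr_ge0_le0 ?neg_cube_ge0 ?transport_le0.
  - have := entropy _ _ (neg_cube_entropy_pair R) _
      (travelling_bump_test (ler0n R a)) (travelling_bump_ge0 _).
    (* The boundary term vanishes because the entropy is zero on the data. *)
    rewrite /weak_form [X in (_ + X)%E](_ : _ = 0)%E ?adde0.
      by move=> H; under eq_integral do rewrite mulrDr.
    rewrite (ae_eq_integral (cst 0%E)) ?integral0 //.
    + apply/measurable_EFinP.
      apply: measurable_funM; first exact: (measurableT_comp mneg (mU0 0)).
      apply: continuous_measurable_fun => x; apply: differentiable_continuous.
      apply/derivable1_diffP.
      by have H := is_derive_travelling_bump_x a%:R (0, x); exact: ex_derive.
    + case: U00 => N [mN N0 sN]; exists N; split => //.
      apply: subset_trans sN => x /=; apply: contra_not => + _.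
      by rewrite /nonneg_states /= -neg_cube_eq0 => /eqP ->; rewrite mul0r.
have := ae_foralln dissipation.
apply: filterS => p Hp Dp; rewrite /nonneg_states /= -neg_cube_eq0.
have [a aP] : exists a : nat,
    (p.1 + 1) ^+ 2 < a%:R /\ (p.2 - p.1) ^+ 2 < a%:R :> R.
  exists (Num.truncn ((p.1 + 1) ^+ 2 + (p.2 - p.1) ^+ 2)).+1.
  have := truncnS_gt ((p.1 + 1) ^+ 2 + (p.2 - p.1) ^+ 2).
  by have := sqr_ge0 (p.1 + 1); have := sqr_ge0 (p.2 - p.1); split; lra.
have /eqP := Hp a Dp; rewrite mulf_eq0 => /orP[//|].
by rewrite lt_eqF // transport_lt0 //; case: aP.
Qed.

(** * The counterexample *)

(** For a speed of at least [1], the intermediate state is a convex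
    combination of the two given ones. *)
Lemma advection_speed (R : realType) :
  wave_speed_estimate (fun u : 'rV[R]_1 => u) (@nonneg_states R) (fun _ _ => 1).
Proof.
move=> UL UR; rewrite /nonneg_states /= => L0 R0; split => // l l0 l1.
rewrite !mxE (_ : _ - _ =
  (2 * l)^-1 * ((l + 1) * UL 0 0 + (l - 1) * UR 0 0)); last by field; lra.
by rewrite mulr_ge0 ?invr_ge0 ?addr_ge0 ?mulr_ge0 //; lra.
Qed.

Theorem theorem4p3 (R : realType) :
  exists (d : nat) (F : 'rV[R]_d -> 'rV[R]_d) (G : set 'rV[R]_d),
    [/\ conservation_law F,
        convex_invariant_domain F G,
        (exists lmax, wave_speed_estimate F G lmax)
      & forall lmax, wave_speed_estimate F G lmax ->
        forall c : R, 0 < c ->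
        exists (x : int -> R) (tau : R) (Ubar U : int -> 'rV[R]_d),
          [/\ mesh x,
              0 < tau,
              (forall j, [/\ G (Ubar j), G (U j) & G (U (j + 1))]),
              (forall j, lmax (U j) (U (j + 1)) * (tau / cell_size x j) <= c)
            & exists j, ~ G (midpoint_value Ubar U j) /\
                        ~ G (updated_average F x tau Ubar U j)]].
Proof.
exists 1%N, (fun u => u), (@nonneg_states R); split.
- exact: advection_law.
- exact: nonneg_states_invariant.
- by exists (fun _ _ => 1); exact: advection_speed.
move=> lmax lmaxP c c0.
pose v (b : bool) : 'rV[R]_1 := const_mx b%:R.
have Gv b : nonneg_states (v b) by rewrite /nonneg_states /= mxE ler0n.
have l0 b b' : 0 <= lmax (v b) (v b') by case: (lmaxP _ _ (Gv b) (Gv b')).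
(* A positive bound for the estimate between the two states in use. *)
pose L := 1 + \sum_b \sum_b' lmax (v b) (v b').
have S0 : 0 <= \sum_b \sum_b' lmax (v b) (v b').
  by apply: sumr_ge0 => b _; exact: sumr_ge0.
have L0 : 0 < L by rewrite ltr_pwDl.
have leL b b' : lmax (v b) (v b') <= L.
  rewrite /L !big_bool /=.
  have := (l0 true true, l0 true false, l0 false true, l0 false false).
  by case: b b' => -[] [[[]]]; lra.
have tau0 : 0 < c / L by rewrite divr_gt0.
pose x (j : int) : R := j%:~R.
have size1 j : cell_size x j = 1.
  by rewrite /cell_size /x intrD addrAC subrr add0r.
exists x, (c / L), (fun=> v false), (fun j => v (j == 1)); split => //.
- split => [j|y]; first by rewrite ltr_int ltzD1.
  by exists (Num.floor y); rewrite ge_floor ltW // floorD1_gt.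
- by move=> j; rewrite size1 divr1 mulrC mulrAC ler_pdivrMr // ler_pM2l.
- exists 0.
  rewrite /nonneg_states /midpoint_value /updated_average /= size1 !mxE /=.
  by split; apply/negP; rewrite -ltNge; lra.
Qed.
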